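(* The column-and-constraint generation scheme (Algorithm 1) described in the context solves the exponential conic program $(\mathrm{P})$ described in the context in finitely many iterations. Moreover, $\mathrm{LB}_t$ and $\mathrm{UB}_t$ constitute monotone sequences of lower and upper bounds on the optimal value of $(\mathrm{P})$.
   Context: Notation: $[N] = \{1, \ldots, N\}$, $\mathbb{B} = \{0,1\}$; $\mathbf{1}[\mathcal{E}]$ is $1$ if $\mathcal{E}$ holds and $0$ otherwise. $\mathbb{C} = \mathbb{C}(k_1) \times \cdots \times \mathbb{C}(k_m)$ with $\mathbb{C}(s) = \{\bm{z} \in \mathbb{B}^{s-1} : \sum_{j \in [s-1]} z_j \leq 1\}$, $k_j \geq 2$, and $k = k_1 + \cdots + k_m - m$. The data are $(\bm{x}^i, \bm{z}^i, y^i) \in \mathbb{R}^n \times \mathbb{C} \times \{-1,+1\}$, $i \in [N]$; $\epsilon > 0$, $\kappa > 0$, $p > 0$ are parameters; $d_{\text{C}}(\bm{z},\bm{z}') = (\sum_{j \in [m]} \mathbf{1}[\bm{z}_j \neq \bm{z}'_j])^{1/p}$; $\|\cdot\|_*$ is the dual norm of a given rational norm $\|\cdot\|$ on $\mathbb{R}^n$; $\mathcal{K}_{\exp} = \mathrm{cl}(\{(a,b,c) : a \geq b \exp(c/b), \, a > 0, \, b > 0\})$, with $\mathrm{cl}$ denoting closure. Problem $(\mathrm{P})$: minimize $\lambda \epsilon + \frac{1}{N} \sum_{i \in [N]} s_i$ over $\bm{\beta} = (\beta_0, \bm{\beta}_{\text{N}}, \bm{\beta}_{\text{C}}) \in \mathbb{R}^{1+n+k}$,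 $\lambda \geq 0$, $\bm{s} \in \mathbb{R}^N$ and $(u_{i,\bm{z}}^{+}, v_{i,\bm{z}}^{+}, u_{i,\bm{z}}^{-}, v_{i,\bm{z}}^{-}) \in \mathbb{R}^4$, $(i,\bm{z}) \in [N] \times \mathbb{C}$, subject to $\|\bm{\beta}_{\text{N}}\|_* \leq \lambda$ and: First constraint set, for all $(i,\bm{z}) \in [N] \times \mathbb{C}$: $u_{i,\bm{z}}^{+} + v_{i,\bm{z}}^{+} \leq 1$, $\;(u_{i,\bm{z}}^{+}, 1, -s_i - \lambda d_{\text{C}}(\bm{z},\bm{z}^i)) \in \mathcal{K}_{\exp}$, $\;(v_{i,\bm{z}}^{+}, 1, -y^i \bm{\beta}_{\text{N}}^\top \bm{x}^i - y^i \bm{\beta}_{\text{C}}^\top \bm{z} - y^i \beta_0 - s_i - \lambda d_{\text{C}}(\bm{z},\bm{z}^i)) \in \mathcal{K}_{\exp}$. Second constraint set, for all $(i,\bm{z}) \in [N] \times \mathbb{C}$: $u_{i,\bm{z}}^{-} + v_{i,\bm{z}}^{-} \leq 1$, $\;(u_{i,\bm{z}}^{-}, 1, -s_i - \lambda d_{\text{C}}(\bm{z},\bm{z}^i) - \lambda\kappa) \in \mathcal{K}_{\exp}$, $\;(v_{i,\bm{z}}^{-}, 1, y^i \bm{\beta}_{\text{N}}^\top \bm{x}^i + y^i \bm{\beta}_{\text{C}}^\top \bm{z} + y^i \beta_0 - s_i - \lambda d_{\text{C}}(\bm{z},\bm{z}^i) - \lambda\kappa) \in \mathcal{K}_{\exp}$.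 Violation: for fixed $(\bm{\beta}, \lambda, \bm{s})$, let the value of index $(i,\bm{z})$ in the first (second) constraint set be the minimum of $u + v$ over all $(u,v)$ satisfying the two conic constraints of that set for $(i,\bm{z})$ (with $u,v$ in place of $u^{\pm}_{i,\bm{z}}, v^{\pm}_{i,\bm{z}}$). The index is violated if its value exceeds $1$; its violation is the positive part of its value minus $1$. A most violated index is one of maximum value over $[N] \times \mathbb{C}$. Algorithm 1: Set $\mathrm{LB}_0 = -\infty$, $\mathrm{UB}_0 = +\infty$ and choose (possibly empty) subsets $\mathcal{W}^+, \mathcal{W}^- \subseteq [N] \times \mathbb{C}$. For $t = 1, 2, \ldots$: (1) let $\theta^\star$ be the optimal value and $(\bm{\beta}, \lambda, \bm{s}, \bm{u}^\pm, \bm{v}^\pm)$ be a minimizer of the reduced problem obtained from $(\mathrm{P})$ by enforcing the first constraint set only for $(i,\bm{z}) \in \mathcal{W}^+$, the second constraint set only for $(i,\bm{z}) \in \mathcal{W}^-$, and including only the variables $(u^+_{i,\bm{z}}, v^+_{i,\bm{z}})$ with $(i,\bm{z}) \in \mathcal{W}^+$ and $(u^-_{i,\bm{z}}, v^-_{i,\bm{z}})$ with $(i,\bm{z}) \in \mathcal{W}^-$; (2) identify a most violated index $(i^+, \bm{z}^+)$ of the first constraint set and add it to $\mathcal{W}^+$, and a most violated index $(i^-, \bm{z}^-)$ of the second constraint set and add it to $\mathcal{W}^-$; let $\vartheta^+$ and $\vartheta^-$ be their respective violations; (3) set $\mathrm{LB}_t = \theta^\star$ and $\mathrm{UB}_t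 = \min\{\mathrm{UB}_{t-1}, \; \theta^\star + \log(1 + \max\{\vartheta^+, \vartheta^-\})\}$; (4) terminate if $\mathrm{LB}_t = \mathrm{UB}_t$.
   Formalization: Assumes N ≥ 1; termination is claimed for runs in which every reduced problem met before termination has a minimizer (it may not, e.g. with both initial sets empty the objective is unbounded below and step (1) is undefined); the bounds hold for all iterations carried out. *)

(* Defs.v *)
From HB Require Import structures.
From mathcomp Require Import all_boot all_order all_algebra.
From mathcomp Require Import all_classical all_reals all_analysis.
Set Implicit Arguments.
Unset Strict Implicit.
Unset Printing Implicit Defensive.
Import Order.TTheory GRing.Theory Num.Theory numFieldNormedType.Exports.
Local Open Scope classical_set_scope.
Local Open Scope ring_scope.

Definition dot (R : pzRingType) (n : nat) (u v : 'rV[R]_n) : R :=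
  (u *m v^T) ord0 ord0.

(* Rational norms are a special case; rationality only matters for tractability. *)
Record is_norm (R : realType) (n : nat) (nrm : 'rV[R]_n -> R) : Prop := IsNorm {
  norm_definite : forall u, nrm u = 0 -> u = 0;
  norm_homogeneous : forall a u, nrm (a *: u) = `|a| * nrm u;
  norm_triangle : forall u v, nrm (u + v) <= nrm u + nrm v }.

Definition dual_norm (R : realType) (n : nat) (nrm : 'rV[R]_n -> R)
    (b : 'rV[R]_n) : R :=
  sup [set dot b u | u in [set u | nrm u <= 1]].

Definition Kexp (R : realType) : set (R * R * R) :=
  closure [set w | [/\ w.1.1 >= w.1.2 * expR (w.2 / w.1.2),
                       w.1.1 > 0 & w.1.2 > 0]].

Definition category (s : nat) : finType :=
  {z : {ffun 'I_s.-1 -> bool} | (\sum_j z j <= 1)%N}.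

Definition categories (m : nat) (k : 'I_m -> nat) : finType :=
  {dffun forall j : 'I_m, category (k j)}.

(* For [k j >= 1] the dimension [\sum_j (k j).-1] is [k_1 + ... + k_m - m]. *)
Definition catvec (R : realType) (m : nat) (k : 'I_m -> nat)
    (z : categories k) : 'rV[R]_(\sum_j (k j).-1) :=
  \mxrow_j \row_l (val (z j) l)%:R.

Record instance (R : realType) (n m N : nat) (k : 'I_m -> nat) := Instance {
  data_x : 'I_N -> 'rV[R]_n;
  data_z : 'I_N -> categories k;
  data_y : 'I_N -> R;
  epsilon : R;
  kappa : R;
  expo : R;                     (* the parameter p in the metric d_C *)
  feature_norm : 'rV[R]_n -> R }.

(* The hypotheses k_j >= 2 and N >= 1 concern the indices of [instance]. *)
Record wf_instance (R : realType) (n m N : nat) (k : 'I_m -> nat)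
    (D : instance R n N k) : Prop := WfInstance {
  wf_label : forall i, data_y D i = -1 \/ data_y D i = 1;
  wf_epsilon : 0 < epsilon D;
  wf_kappa : 0 < kappa D;
  wf_expo : 0 < expo D;
  wf_norm : is_norm (feature_norm D) }.

(* The decision variables other than u and v. *)
Record master (R : realType) (n m N : nat) (k : 'I_m -> nat) := Master {
  beta0 : R;
  betaN : 'rV[R]_n;
  betaC : 'rV[R]_(\sum_j (k j).-1);
  lambda : R;
  slack : 'I_N -> R }.

Section Program.
Context (R : realType) (n m N : nat) (k : 'I_m -> nat).
Context (D : instance R n N k).

Definition conindex : finType := ('I_N * categories k)%type.

Implicit Types (q : master R n N k) (iz : conindex) (Wp Wm : {set conindex}).

Definition dC (z z' : categories k) : R :=
  ((\sum_(j < m) (z j != z' j))%N)%:R `^ (expo D)^-1.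

Definition objective q : R :=
  lambda q * epsilon D + N%:R^-1 * \sum_i slack q i.

Definition margin q iz : R :=
  data_y D iz.1 * dot (betaN q) (data_x D iz.1)
  + data_y D iz.1 * dot (betaC q) (catvec R iz.2)
  + data_y D iz.1 * beta0 q.

Definition offset q iz : R :=
  - slack q iz.1 - lambda q * dC iz.2 (data_z D iz.1).

Definition conic_plus q iz (u v : R) : Prop :=
  Kexp (u, 1, offset q iz) /\ Kexp (v, 1, - margin q iz + offset q iz).

Definition conic_minus q iz (u v : R) : Prop :=
  Kexp (u, 1, offset q iz - lambda q * kappa D) /\
  Kexp (v, 1, margin q iz + offset q iz - lambda q * kappa D).

Definition master_feasible q : Prop :=
  0 <= lambda q /\ dual_norm (feature_norm D) (betaN q) <= lambda q.

Record solution := Solution {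
  sol_master : master R n N k;
  sol_up : conindex -> R;
  sol_vp : conindex -> R;
  sol_um : conindex -> R;
  sol_vm : conindex -> R }.

Definition feasible (w : solution) : Prop :=
  [/\ master_feasible (sol_master w),
      forall iz, sol_up w iz + sol_vp w iz <= 1 /\
        conic_plus (sol_master w) iz (sol_up w iz) (sol_vp w iz)
    & forall iz, sol_um w iz + sol_vm w iz <= 1 /\
        conic_minus (sol_master w) iz (sol_um w iz) (sol_vm w iz)].

Definition optimal_value : \bar R :=
  ereal_inf [set (objective (sol_master w))%:E | w in feasible].

Definition minimizer (w : solution) : Prop :=
  feasible w /\ forall w', feasible w' ->
    objective (sol_master w) <= objective (sol_master w').

Record rsolution Wp Wm := RSolution {
  rsol_master : master R n N k;
  rsol_up : {iz | iz \in Wp} -> R;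
  rsol_vp : {iz | iz \in Wp} -> R;
  rsol_um : {iz | iz \in Wm} -> R;
  rsol_vm : {iz | iz \in Wm} -> R }.

Definition reduced_feasible Wp Wm (w : rsolution Wp Wm) : Prop :=
  [/\ master_feasible (rsol_master w),
      forall a, rsol_up w a + rsol_vp w a <= 1 /\
        conic_plus (rsol_master w) (val a) (rsol_up w a) (rsol_vp w a)
    & forall a, rsol_um w a + rsol_vm w a <= 1 /\
        conic_minus (rsol_master w) (val a) (rsol_um w a) (rsol_vm w a)].

Definition reduced_value Wp Wm : \bar R :=
  ereal_inf [set (objective (rsol_master w))%:E
            | w in @reduced_feasible Wp Wm].

Definition reduced_minimizer Wp Wm (w : rsolution Wp Wm) : Prop :=
  reduced_feasible w /\ forall w' : rsolution Wp Wm, reduced_feasible w' ->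
    objective (rsol_master w) <= objective (rsol_master w').

(* These infima are attained, at the exponentials of the third coordinates. *)
Definition value_plus q iz : R :=
  inf [set uv.1 + uv.2 | uv in [set uv : R * R | conic_plus q iz uv.1 uv.2]].

Definition value_minus q iz : R :=
  inf [set uv.1 + uv.2 | uv in [set uv : R * R | conic_minus q iz uv.1 uv.2]].

Definition violation (value : conindex -> R) iz : R := Num.max (value iz - 1) 0.

Definition most_violated (value : conindex -> R) iz : Prop :=
  forall iz', value iz' <= value iz.

(* Everything is indexed by the iteration number t >= 1.  The sets
   [run_Wp t] and [run_Wm t] are those in force when iteration t starts, and
   entry 0 is meaningful for [run_LB] and [run_UB] only. *)
Record run := Run {
  run_Wp : nat -> {set conindex};
  run_Wm : nat -> {set conindex};
  run_sol : forall t, rsolution (run_Wp t) (run_Wm t);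
  run_ip : nat -> conindex;
  run_im : nat -> conindex;
  run_LB : nat -> \bar R;
  run_UB : nat -> \bar R }.

Implicit Types r : run.

Definition run_master r t : master R n N k := rsol_master (run_sol r t).

Definition run_theta r t : \bar R := reduced_value (run_Wp r t) (run_Wm r t).

Definition run_gap r t : R :=
  ln (1 + Num.max (violation (value_plus (run_master r t)) (run_ip r t))
                  (violation (value_minus (run_master r t)) (run_im r t))).

Definition initialized Wp Wm r : Prop :=
  [/\ run_Wp r 1%N = Wp, run_Wm r 1%N = Wm,
      run_LB r 0%N = -oo%E & run_UB r 0%N = +oo%E].

Record iteration r (t : nat) : Prop := Iteration {
  it_minimizer : reduced_minimizer (run_sol r t);
  it_ip : most_violated (value_plus (run_master r t)) (run_ip r t);
  it_im : most_violated (value_minus (run_master r t)) (run_im r t);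
  it_Wp : run_Wp r t.+1 = run_ip r t |: run_Wp r t;
  it_Wm : run_Wm r t.+1 = run_im r t |: run_Wm r t;
  it_LB : run_LB r t = run_theta r t;
  it_UB : run_UB r t =
          Order.min (run_UB r t.-1) (run_theta r t + (run_gap r t)%:E)%E }.

Definition terminated r (t : nat) : Prop := run_LB r t = run_UB r t.

(* Iterations 1, ..., T have been carried out; the last one may or may not
   have triggered the termination test. *)
Definition executes Wp Wm r (T : nat) : Prop :=
  initialized Wp Wm r /\
  forall t, (1 <= t <= T)%N -> iteration r t /\ ((t < T)%N -> ~ terminated r t).

(* The loop is carried on for as long as the termination test fails. *)
Definition full_run Wp Wm r : Prop :=
  initialized Wp Wm r /\
  forall t, (1 <= t)%N ->
    (forall t', (1 <= t' < t)%N -> ~ terminated r t') -> iteration r t.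

Definition shift_slack q (delta : R) : master R n N k :=
  Master (beta0 q) (betaN q) (betaC q) (lambda q)
         (fun i => slack q i + delta).

End Program.

(* Main.v *)
(* Eliminating the auxiliary variables, an index is satisfied iff its value, a
   sum of two exponentials, is at most 1.  Adding delta to every s_i multiplies
   all values by exp(-delta), so delta = log(1 + maximal violation) turns the
   minimizer of a reduced problem into a feasible point of (P) whose objective
   has grown by exactly delta: this is the upper bound.  The sets W+ and W- can
   grow only finitely often; once neither does, the most violated indices
   are already enforced, hence not violated, and the two bounds meet. *)

Require Import Defs.
From HB Require Import structures.
From mathcomp Require Import all_boot all_order all_algebra.
From mathcomp Require Import all_classical all_reals all_analysis.
From mathcomp Require Import zify ring.
Set Implicit Arguments.
Unset Strict Implicit.
Unset Printing Implicit Defensive.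
Import Order.TTheory GRing.Theory Num.Theory numFieldNormedType.Exports.
Local Open Scope classical_set_scope.
Local Open Scope ring_scope.

(** * The exponential cone at middle coordinate 1 *)

Lemma Kexp1 (R : realType) (a c : R) : Kexp (a, 1, c) <-> expR c <= a.
Proof.
split=> [cl|le_ca]; last first.
  apply: subset_closure; split => /=; rewrite ?ltr01//.
    by rewrite mul1r divr1.
  exact: lt_le_trans (expR_gt0 _) le_ca.
rewrite leNgt; apply/negP => lt_ac.
(* The generating set lies in [f >= 0]. Since the middle coordinate is nonzero at [(a, 1, c)], [f]
   is continuous there, so a negative value of [f] would give a neighbourhood missing that set. *)
pose f (w : R * R * R) := w.1.1 - w.1.2 * expR (w.2 / w.1.2).
have fst2 : continuous (fun w : R * R * R => w.1.1).
  by move=> w; apply: (@cvg_comp _ _ _ fst fst); [exact: cvg_fst|exact: cvg_fst].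
have snd2 : continuous (fun w : R * R * R => w.1.2).
  by move=> w; apply: (@cvg_comp _ _ _ fst snd); [exact: cvg_fst|exact: cvg_snd].
have cf : {for (a, 1, c), continuous f}.
  apply: cvgB; first exact: fst2.
  apply: cvgM; first exact: snd2.
  apply: continuous_comp; last exact: continuous_expR.
  apply: cvgM; first exact: cvg_snd.
  by apply: cvgV; [rewrite /= oner_neq0|exact: snd2].
have f_lt0 : f (a, 1, c) < 0 by rewrite /f /= mul1r divr1 subr_lt0.
have [w [[le_w _ _]]] := cl _ (cf _ (lt_nbhsl f_lt0)).
by rewrite /= /f subr_lt0 ltNge le_w.
Qed.

Lemma inf_Kexp1 (R : realType) (a b : R) :
  inf [set uv.1 + uv.2 | uv in
        [set uv : R * R | Kexp (uv.1, 1, a) /\ Kexp (uv.2, 1, b)]] =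
  expR a + expR b.
Proof.
set A := (X in inf X).
have Aab : A (expR a + expR b) by exists (expR a, expR b) => //=; split; apply/Kexp1.
have lbA : lbound A (expR a + expR b).
  by move=> _ [[u v] /= [/Kexp1 ? /Kexp1 ?] <-]; exact: lerD.
apply/eqP; rewrite eq_le; apply/andP; split.
  by apply: ge_inf => //; exists (expR a + expR b).
by apply: lb_le_inf => //; exists (expR a + expR b).
Qed.

Section ColumnConstraintGeneration.
Context (R : realType) (n m N : nat) (k : 'I_m -> nat).
Context (D : instance R n N k).

Implicit Types (q : master R n N k) (iz : conindex N k).
Implicit Types (Wp Wm : {set conindex N k}) (r : run R n N k).

(** * Elimination of the auxiliary variables *)

Lemma value_plusE q iz : value_plus D q iz =
  expR (offset D q iz) + expR (- margin D q iz + offset D q iz).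
Proof. exact: inf_Kexp1. Qed.

Lemma value_minusE q iz : value_minus D q iz =
  expR (offset D q iz - lambda q * kappa D) +
  expR (margin D q iz + offset D q iz - lambda q * kappa D).
Proof. exact: inf_Kexp1. Qed.

Lemma value_plus_le1 q iz u v :
  u + v <= 1 /\ conic_plus D q iz u v -> value_plus D q iz <= 1.
Proof.
move=> [uv1 [/Kexp1 ? /Kexp1 ?]]; rewrite value_plusE.
by apply: le_trans uv1; exact: lerD.
Qed.

Lemma value_minus_le1 q iz u v :
  u + v <= 1 /\ conic_minus D q iz u v -> value_minus D q iz <= 1.
Proof.
move=> [uv1 [/Kexp1 ? /Kexp1 ?]]; rewrite value_minusE.
by apply: le_trans uv1; exact: lerD.
Qed.

(** The projection of a reduced feasible set onto the master variables; with both sets full it is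
    that of (P). *)
Definition satisfies Wp Wm q : Prop :=
  [/\ master_feasible D q,
      forall iz, iz \in Wp -> value_plus D q iz <= 1
    & forall iz, iz \in Wm -> value_minus D q iz <= 1].

(** Takes the smallest [u] and [v] the cones allow, so that [u + v] equals the value of the
    index. *)
Definition reduced_completion Wp Wm q : rsolution R n Wp Wm :=
  RSolution q
    (fun a => expR (offset D q (val a)))
    (fun a => expR (- margin D q (val a) + offset D q (val a)))
    (fun a => expR (offset D q (val a) - lambda q * kappa D))
    (fun a => expR (margin D q (val a) + offset D q (val a)
                    - lambda q * kappa D)).

Definition completion q : solution R n N k :=
  Solution q
    (fun iz => expR (offset D q iz))
    (fun iz => expR (- margin D q iz + offset D q iz))
    (fun iz => expR (offset D q iz - lambda q * kappa D))
    (fun iz => expR (margin D q iz + offset D q iz - lambda q * kappa D)).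

Lemma reduced_feasible_satisfies Wp Wm (w : rsolution R n Wp Wm) :
  reduced_feasible D w -> satisfies Wp Wm (rsol_master w).
Proof.
move=> [fw plus minus]; split=> // iz Wiz.
  exact: value_plus_le1 (plus (exist _ iz Wiz)).
exact: value_minus_le1 (minus (exist _ iz Wiz)).
Qed.

Lemma reduced_completion_feasible Wp Wm q :
  satisfies Wp Wm q -> reduced_feasible D (reduced_completion Wp Wm q).
Proof.
move=> [fq plus minus]; split=> //= -[iz Wiz] /=.
  by rewrite -value_plusE; split; [exact: plus|split; apply/Kexp1].
by rewrite -value_minusE; split; [exact: minus|split; apply/Kexp1].
Qed.

Lemma feasible_satisfies (w : solution R n N k) :
  feasible D w -> satisfies [set: _]%SET [set: _]%SET (sol_master w).
Proof.
move=> [fw plus minus]; split=> // iz _.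
  exact: value_plus_le1 (plus iz).
exact: value_minus_le1 (minus iz).
Qed.

Lemma completion_feasible q :
  satisfies [set: _]%SET [set: _]%SET q -> feasible D (completion q).
Proof.
move=> [fq plus minus]; split=> //= iz.
  by rewrite -value_plusE; split; [exact: plus|split; apply/Kexp1].
by rewrite -value_minusE; split; [exact: minus|split; apply/Kexp1].
Qed.

Lemma reduced_valueE Wp Wm : reduced_value D Wp Wm =
  ereal_inf [set (objective D q)%:E | q in satisfies Wp Wm].
Proof.
congr ereal_inf; apply/seteqP; split=> _ [w fw <-].
  by exists (rsol_master w) => //; exact: reduced_feasible_satisfies.
exists (reduced_completion Wp Wm w) => //.
exact: reduced_completion_feasible.
Qed.

(** The two solution types differ, but both feasible sets have the same projection and the objective
    depends on the master variables only. *)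
Lemma optimal_valueE :
  optimal_value D = reduced_value D [set: _]%SET [set: _]%SET.
Proof.
rewrite reduced_valueE; congr ereal_inf; apply/seteqP; split=> _ [w fw <-].
  by exists (sol_master w) => //; exact: feasible_satisfies.
by exists (completion w) => //; exact: completion_feasible.
Qed.

(** Enforcing more indices shrinks the feasible set; this gives both validity and monotonicity of
    the lower bounds. *)
Lemma reduced_value_le Wp Wm Wp' Wm' : Wp \subset Wp' -> Wm \subset Wm' ->
  (reduced_value D Wp Wm <= reduced_value D Wp' Wm')%E.
Proof.
move=> /fintype.subsetP sp /fintype.subsetP sm; rewrite !reduced_valueE.
apply: ereal_inf_le_tmp => _ [q [fq plus minus] <-]; exists q => //.
by split=> // iz Wiz; [apply: plus; exact: sp|apply: minus; exact: sm].
Qed.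

Lemma reduced_value_le_optimal Wp Wm :
  (reduced_value D Wp Wm <= optimal_value D)%E.
Proof. by rewrite optimal_valueE; apply: reduced_value_le; exact: finset.subsetT. Qed.

Lemma reduced_minimizer_value Wp Wm (w : rsolution R n Wp Wm) :
  reduced_minimizer D w ->
  reduced_value D Wp Wm = (objective D (rsol_master w))%:E.
Proof.
move=> [fw minw]; apply/eqP; rewrite eq_le; apply/andP; split.
  by apply: ereal_inf_lbound; exists w.
by apply: le_ereal_inf_tmp => _ [w' fw' <-]; rewrite lee_fin; exact: minw.
Qed.

(** * Effect of shifting the slacks *)

Lemma value_plus_shift q delta iz :
  value_plus D (shift_slack q delta) iz = expR (- delta) * value_plus D q iz.
Proof.
rewrite !value_plusE mulrDr -!expRD.
by congr (expR _ + expR _); rewrite /offset /margin /=; ring.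
Qed.

Lemma value_minus_shift q delta iz :
  value_minus D (shift_slack q delta) iz = expR (- delta) * value_minus D q iz.
Proof.
rewrite !value_minusE mulrDr -!expRD.
by congr (expR _ + expR _); rewrite /offset /margin /=; ring.
Qed.

(** The weights [N%:R^-1] of the [N] slacks sum to 1, which is where [0 < N] enters. *)
Lemma objective_shift q delta : (0 < N)%N ->
  objective D (shift_slack q delta) = objective D q + delta.
Proof.
move=> N_gt0; rewrite /objective /= big_split /= sumr_const card_ord mulrDr.
rewrite addrA; congr (_ + _); rewrite -(mulr_natl delta) mulKf//.
by rewrite pnatr_eq0 -lt0n.
Qed.

Lemma expR_run_gap r t : expR (run_gap D r t) =
  1 + Num.max (violation (value_plus D (run_master r t)) (run_ip r t))
              (violation (value_minus D (run_master r t)) (run_im r t)).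
Proof.
apply: lnK; rewrite posrE; apply: ltr_wpDr; last exact: ltr01.
by rewrite le_max /violation le_max lexx orbT.
Qed.

(** * Consequences of a single iteration *)

Section Iteration.
Context (r : run R n N k) (t : nat) (it_t : iteration D r t).

Lemma run_thetaE : run_theta D r t = (objective D (run_master r t))%:E.
Proof. exact: reduced_minimizer_value (it_minimizer it_t). Qed.

(** Every value is at most that of the most violated index, hence at most the exponential of the
    gap, by which the shift divides. Master feasibility does not involve the slacks. *)
Lemma iteration_shift_satisfies :
  satisfies [set: _]%SET [set: _]%SET
    (shift_slack (run_master r t) (run_gap D r t)).
Proof.
have [fq _ _] := reduced_feasible_satisfies (it_minimizer it_t).1.
split=> // iz _.
  rewrite value_plus_shift expRN mulrC ler_pdivrMr ?expR_gt0// mul1r.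
  rewrite expR_run_gap; apply: le_trans (it_ip it_t iz) _.
  by rewrite -lerBlDl le_max /violation le_max lexx.
rewrite value_minus_shift expRN mulrC ler_pdivrMr ?expR_gt0// mul1r.
rewrite expR_run_gap; apply: le_trans (it_im it_t iz) _.
by rewrite -lerBlDl le_max /violation [X in _ || X]le_max lexx orbT.
Qed.

Lemma objective_iteration_shift : (0 < N)%N ->
  (objective D (shift_slack (run_master r t) (run_gap D r t)))%:E =
  (run_theta D r t + (run_gap D r t)%:E)%E.
Proof. by move=> N_gt0; rewrite objective_shift// run_thetaE. Qed.

Lemma optimal_value_le_shift : (0 < N)%N ->
  (optimal_value D <= run_theta D r t + (run_gap D r t)%:E)%E.
Proof.
move=> N_gt0; rewrite -objective_iteration_shift//; apply: ereal_inf_lbound.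
exists (completion (shift_slack (run_master r t) (run_gap D r t))) => //.
exact: completion_feasible iteration_shift_satisfies.
Qed.

Lemma run_gap_eq0 :
  run_ip r t \in run_Wp r t -> run_im r t \in run_Wm r t -> run_gap D r t = 0.
Proof.
have [_ plus minus] := reduced_feasible_satisfies (it_minimizer it_t).1.
move=> /plus plus1 /minus minus1; rewrite /run_gap /violation.
by rewrite !max_r ?subr_le0// addr0 ln1.
Qed.

End Iteration.

(** * Upper bounds and finite termination *)

Lemma run_UB_ge_optimal r T : (0 < N)%N -> run_UB r 0 = +oo%E ->
  (forall t, (1 <= t <= T)%N -> iteration D r t) ->
  (optimal_value D <= run_UB r T)%E.
Proof.
move=> N_gt0 UB0; elim: T => [|T IH] itT; first by rewrite UB0 leey.
have it_T := itT T.+1 (leqnn _).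
rewrite (it_UB it_T) le_min IH ?optimal_value_le_shift//.
by move=> t /andP[t1 tT]; apply: itT; rewrite t1 leqW.
Qed.

(** A running minimum is attained by one of its terms; the initial [+oo] drops out at the first
    iteration. The attaining iteration later supplies the minimizer of (P). *)
Lemma run_UB_attained r T : (0 < T)%N -> run_UB r 0 = +oo%E ->
  (forall t, (1 <= t <= T)%N -> iteration D r t) ->
  exists2 t, (1 <= t <= T)%N &
    run_UB r T = (run_theta D r t + (run_gap D r t)%:E)%E.
Proof.
case: T => // T _ UB0; elim: T => [|T IH] itT.
  by exists 1%N => //; rewrite (it_UB (itT 1%N isT)) UB0 minye.
have it_T := itT T.+2 (leqnn _).
rewrite (it_UB it_T) /=; case: leP => _; last by exists T.+2; rewrite ?leqnn.
have [|t /andP[t1 tT] ->] := IH.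
  by move=> t /andP[t1 tT]; apply: itT; rewrite t1 leqW.
by exists t; rewrite // t1 leqW.
Qed.

(** The gap vanishes, so the new upper bound is at most [run_theta]; the reverse inequality passes
    through the optimal value. *)
Lemma stationary_terminated r t : (0 < N)%N -> iteration D r t ->
  (optimal_value D <= run_UB r t)%E ->
  run_ip r t \in run_Wp r t -> run_im r t \in run_Wm r t -> terminated r t.
Proof.
move=> N_gt0 it_t optUB ipW imW; apply/eqP; rewrite /terminated eq_le.
apply/andP; split.
  by rewrite (it_LB it_t); apply: le_trans optUB; exact: reduced_value_le_optimal.
rewrite (it_LB it_t) (it_UB it_t) (run_gap_eq0 it_t)// adde0.
by rewrite ge_min lexx orbT.
Qed.

Lemma full_run_terminates Wp Wm r : (0 < N)%N -> full_run D Wp Wm r ->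
  exists T, (1 <= T)%N /\ terminated r T.
Proof.
move=> N_gt0 [[_ _ _ UB0] run_r]; apply: contrapT => /forallNP nterm.
have it_r t : (1 <= t)%N -> iteration D r t.
  by move=> t1; apply: run_r => // t' /andP[t'1 _] term; apply: (nterm t').
(* Without termination, each iteration adds a new index to at least one of the two sets; those at
   [t.+1] result from [t] iterations. *)
have grow t : (t <= #|run_Wp r t.+1| + #|run_Wm r t.+1|)%N.
  elim: t => // t IH; have it_t := it_r t.+1 isT.
  rewrite (it_Wp it_t) (it_Wm it_t) !cardsU1.
  have : ~~ ((run_ip r t.+1 \in run_Wp r t.+1)
             && (run_im r t.+1 \in run_Wm r t.+1)).
    apply/negP => /andP[ipW imW]; apply: (nterm t.+1); split=> //.
    apply: stationary_terminated => //; apply: run_UB_ge_optimal => //.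
    by move=> t' /andP[t'1 _]; exact: it_r.
  move: IH; move: #|run_Wp r t.+1| #|run_Wm r t.+1| => a b.
  by case: (_ \in _); case: (_ \in _) => //=; lia.
(* One iteration more than the two sets together can absorb. *)
have := grow (#|conindex N k| + #|conindex N k|).+1.
by rewrite leqNgt ltnS leq_add// max_card.
Qed.

Lemma full_run_executes Wp Wm r : (0 < N)%N -> full_run D Wp Wm r ->
  exists T, [/\ (1 <= T)%N, executes D Wp Wm r T & terminated r T].
Proof.
move=> N_gt0 run_r.
(* The least such [T] is needed: [executes] forbids earlier termination, and [full_run] guarantees
   nothing after it. *)
pose P T := (1 <= T)%N && `[< terminated r T >].
have exP : exists T, P T.
  have [T [T1 termT]] := full_run_terminates N_gt0 run_r.
  by exists T; rewrite /P T1; apply/asboolP.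
case: (ex_minnP exP) => T /andP[T1 /asboolP termT] minT.
have nterm t : (1 <= t < T)%N -> ~ terminated r t.
  move=> /andP[t1 tT] termt; have := minT t.
  by rewrite /P t1 leqNgt tT; move=> /(_ (introT (asboolP _) termt)).
exists T; split=> //; split; first exact: run_r.1.
move=> t /andP[t1 tT]; split; last by move=> tT'; apply: nterm; rewrite t1.
apply: run_r.2 => // t' /andP[t'1 t't]; apply: nterm.
by rewrite t'1 (leq_trans t't).
Qed.

(** * Monotone bounds and optimality at termination *)

Lemma executes_monotone Wp Wm r T t : executes D Wp Wm r T -> (t < T)%N ->
  (run_LB r t <= run_LB r t.+1)%E /\ (run_UB r t.+1 <= run_UB r t)%E.
Proof.
move=> [[_ _ LB0 _] it_r] tT; have it_t1 := (it_r t.+1 tT).1.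
split; last by rewrite (it_UB it_t1) ge_min lexx.
case: t tT it_t1 => [|t] tT it_t1; first by rewrite LB0 leNye.
have it_t := (it_r t.+1 (ltnW tT)).1.
rewrite (it_LB it_t) (it_LB it_t1) /run_theta (it_Wp it_t) (it_Wm it_t).
by apply: reduced_value_le; exact: finset.subsetUr.
Qed.

Lemma executes_bounds Wp Wm r T t : (0 < N)%N -> executes D Wp Wm r T ->
  (t <= T)%N ->
  (run_LB r t <= optimal_value D)%E /\ (optimal_value D <= run_UB r t)%E.
Proof.
move=> N_gt0 [[_ _ LB0 UB0] it_r] tT; split.
  case: t tT => [|t] tT; first by rewrite LB0 leNye.
  by rewrite (it_LB (it_r t.+1 tT).1); exact: reduced_value_le_optimal.
apply: run_UB_ge_optimal => // t' /andP[t'1 t't].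
by apply: (it_r t' _).1; rewrite t'1 (leq_trans t't).
Qed.

(** Equal bounds squeeze the optimal value. The shifted iterate behind the upper bound, possibly
    from an earlier iteration, is feasible for (P) with that objective. *)
Lemma executes_minimizer Wp Wm r T : (0 < N)%N -> (1 <= T)%N ->
  executes D Wp Wm r T -> terminated r T ->
  run_LB r T = optimal_value D /\
  exists (t : nat) (w : solution R n N k),
    [/\ (1 <= t <= T)%N,
        run_UB r T = (run_theta D r t + (run_gap D r t)%:E)%E,
        sol_master w = shift_slack (run_master r t) (run_gap D r t)
      & minimizer D w].
Proof.
move=> N_gt0 T1 exec term.
have [LBopt optUB] := executes_bounds N_gt0 exec (leqnn T).
have LBE : run_LB r T = optimal_value D.
  by apply/eqP; rewrite eq_le LBopt term.
split=> //; have [[_ _ _ UB0] it_r] := exec.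
have [|t tT UBE] := run_UB_attained T1 UB0; first by move=> t /it_r[].
have it_t := (it_r t tT).1.
exists t, (completion (shift_slack (run_master r t) (run_gap D r t))).
split=> //; split.
  exact: completion_feasible (iteration_shift_satisfies it_t).
move=> w fw; rewrite -lee_fin /= objective_iteration_shift// -UBE -term LBE.
by apply: ereal_inf_lbound; exists w.
Qed.

(** * Existence of runs *)

Lemma conindex_inhabited : (0 < N)%N -> exists iz : conindex N k, True.
Proof.
move=> N_gt0.
have z0 s : category s.
  by exists [ffun=> false]; rewrite big1 // => i _; rewrite ffunE.
by exists (Ordinal N_gt0, finfun (fun j => z0 (k j))).
Qed.

Lemma most_violated_exists (value : conindex N k -> R) : (0 < N)%N ->
  exists iz, most_violated value iz.
Proof.
move=> /conindex_inhabited[iz0 _].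
exists [arg max_(iz > iz0) value iz]%O => iz'.
by case: arg_maxP => // iz _; apply.
Qed.

Lemma full_run_exists Wp Wm : (0 < N)%N ->
  (forall Wp' Wm' : {set conindex N k}, Wp \subset Wp' -> Wm \subset Wm' ->
     exists w : rsolution R n Wp' Wm', reduced_minimizer D w) ->
  exists r : run R n N k, full_run D Wp Wm r.
Proof.
move=> N_gt0 exmin.
have exw : forall W : {set conindex N k} * {set conindex N k},
    exists w : rsolution R n W.1 W.2,
      Wp \subset W.1 -> Wm \subset W.2 -> reduced_minimizer D w.
  move=> W; have [/andP[sp sm]|/negP ns] :=
    boolP ((Wp \subset W.1) && (Wm \subset W.2)).
    by have [w wP] := exmin _ _ sp sm; exists w.
  (* An arbitrary default makes the choice total on pairs that do not contain the initial sets. *)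
  exists (reduced_completion _ _ (Master 0 0 0 0 (fun=> 0))) => sp sm.
  by case: ns; rewrite sp sm.
pose pick W := sval (cid (exw W)).
have pickP (W : {set conindex N k} * {set conindex N k}) :
    Wp \subset W.1 -> Wm \subset W.2 -> reduced_minimizer D (pick W).
  exact: svalP (cid (exw W)).
pose top v := sval (cid (most_violated_exists v N_gt0)).
have topP v : most_violated v (top v) by exact: svalP (cid _).
pose ip W := top (value_plus D (rsol_master (pick W))).
pose im W := top (value_minus D (rsol_master (pick W))).
pose step (W : {set conindex N k} * {set conindex N k}) :=
  (ip W |: W.1, im W |: W.2).
(* The predecessor makes iteration 1 start from the initial sets. *)
pose state t := iter t.-1 step (Wp, Wm).
pose r0 UB := @Run R n m N k (fun t => (state t).1) (fun t => (state t).2)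
  (fun t => pick (state t)) (ip \o state) (im \o state)
  (fun t => if t is 0 then -oo%E else reduced_value D (state t).1 (state t).2)
  UB.
(* [run_theta] and [run_gap] do not read the upper bounds, so a run with dummy ones provides the
   terms of the recursion for [UB]. *)
pose r1 := r0 (fun=> +oo%E).
pose UB := fix UB t := if t is t'.+1 then
  Order.min (UB t') (run_theta D r1 t + (run_gap D r1 t)%:E)%E else +oo%E.
exists (r0 UB); split=> // -[//|t] _ _.
have [sp sm] : Wp \subset (state t.+1).1 /\ Wm \subset (state t.+1).2.
  elim: t => [|t [sp sm]] //=.
  by split; [apply: fintype.subset_trans sp _|apply: fintype.subset_trans sm _];
     exact: finset.subsetUr.
by split=> //; exact: pickP.
Qed.

End ColumnConstraintGeneration.

Theorem theorem4 (R : realType) (n m N : nat) (k : 'I_m -> nat)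
    (D : instance R n N k) (Wp Wm : {set conindex N k})
    (hN : (0 < N)%N) (hk : forall j, (2 <= k j)%N) (hD : wf_instance D) :
  [/\ (* the algorithm terminates after finitely many iterations *)
      forall r : run R n N k, full_run D Wp Wm r ->
        exists T : nat, [/\ (1 <= T)%N, executes D Wp Wm r T & terminated r T],
      (* upon termination, (P) is solved: its optimal value is the common value
         of the bounds, and it is attained by the iterate behind the best upper
         bound, with s shifted by the logarithmic gap *)
      forall (r : run R n N k) (T : nat), (1 <= T)%N ->
        executes D Wp Wm r T -> terminated r T ->
        run_LB r T = optimal_value D /\
        exists (t : nat) (w : solution R n N k),
          [/\ (1 <= t <= T)%N,
              run_UB r T = (run_theta D r t + (run_gap D r t)%:E)%E,
              sol_master w = shift_slack (run_master r t) (run_gap D r t)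
            & minimizer D w],
      (* monotone lower and upper bounds *)
      forall (r : run R n N k) (T : nat), executes D Wp Wm r T ->
        (forall t : nat, (t < T)%N ->
           (run_LB r t <= run_LB r t.+1)%E /\
           (run_UB r t.+1 <= run_UB r t)%E) /\
        (forall t : nat, (t <= T)%N ->
           (run_LB r t <= optimal_value D)%E /\
           (optimal_value D <= run_UB r t)%E)
    & (* the algorithm can be run whenever its reduced problems have minimizers *)
      (forall Wp' Wm' : {set conindex N k}, Wp \subset Wp' -> Wm \subset Wm' ->
         exists w : rsolution R n Wp' Wm', reduced_minimizer D w) ->
      exists r : run R n N k, full_run D Wp Wm r].
Proof.
split.
- by move=> r; exact: full_run_executes.
- by move=> r T T1; exact: executes_minimizer.
- move=> r T exec; split=> t tT; first exact: executes_monotone exec tT.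
  exact: executes_bounds exec tT.
- exact: full_run_exists.
Qed.
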